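(* Let $\alpha$ be real with $|\alpha|>1$ and let $\beta\neq0$ be the real number with $\alpha^2=1+\beta^2$ and having the same sign as $\alpha$. The conjugate surface of the unduloid $\mathcal{U}_\alpha$ in $\mathbb{S}^2\times\mathbb{R}$ is the helicoid $\mathcal{H}_\beta$ in $\mathbb{S}^2\times\mathbb{R}$.
   Context: $\mathbb{S}^2\times\mathbb{R}\subset\mathbb{R}^3\times\mathbb{R}=\mathbb{R}^4$, where $\mathbb{S}^2$ is the unit sphere. Helicoid $\mathcal{H}_\beta$ ($\beta\ne0$): the surface given by the conformal minimal immersion $$x(u,v)=(\sin\varphi(u)\cos\beta v,\ \sin\varphi(u)\sin\beta v,\ \cos\varphi(u),\ v),$$ where $\varphi'^2=1+\beta^2\sin^2\varphi$, $\varphi''=\beta^2\sin\varphi\cos\varphi$, $\varphi(0)=0$, $\varphi'>0$, with unit normal $N=\frac{1}{\varphi'(u)}(\sin\beta v,-\cos\beta v,0,\beta\sin\varphi(u))$. Unduloid $\mathcal{U}_\alpha$ ($|\alpha|>1$): the surface given by the conformal minimal immersion $$x(u,v)=(\sin\psi(u)\cos\alpha v,\ \sin\psi(u)\sin\alpha v,\ \cos\psi(u),\ u),$$ where $1+\psi'^2=\alpha^2\sin^2\psi$, $\psi''=\alpha^2\sin\psi\cos\psi$, $\psi'(0)=0$, $\psi(u)\in(0,\pi)$, $\cos\psi(0)>0$, with unit normal $N=\frac{1}{\alpha\sin\psi(u)}(-\cos\psi(u)\cos\alpha v,-\cos\psi(u)\sin\alpha v,\sin\psi(u),\psi'(u))$.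 In both cases $(u,v)\in\mathbb{R}^2$, with $z=u+iv$ as conformal coordinate. Conjugation: for a conformal minimal immersion $x:\Sigma\to\mathbb{M}^2\times\mathbb{R}$ ($\mathbb{M}^2=\mathbb{S}^2$ or $\mathbb{H}^2$) of a simply connected Riemann surface with unit normal $N$, let $ds^2$ be the induced metric, $S$ the symmetric operator on $\Sigma$ with $dx(SX)=-\bar\nabla_XN$ ($\bar\nabla$ the connection of $\mathbb{M}^2\times\mathbb{R}$), $T$ the vector field on $\Sigma$ with $dx(T)$ equal to the tangential projection of $\frac{\partial}{\partial t}$ (the unit vector field of the factor $\mathbb{R}$), and $\nu=\langle N,\frac{\partial}{\partial t}\rangle$. Let $J$ be the rotation by $\frac\pi2$ on $T\Sigma$. The conjugate immersion of $x$ is the conformal minimal immersion of $\Sigma$ whose corresponding data are $(ds^2,JS,JT,\nu)$; it is well defined up to isometries of $\mathbb{M}^2\times\mathbb{R}$ preserving the orientations of both $\mathbb{M}^2$ and $\mathbb{R}$, and conjugate surfaces are considered up to such isometries. The surface it parametrizes is the conjugate surface. The unit normals are the ones for which $(dx(e_1),dx(e_2),N)$ is direct for direct frames $(e_1,e_2)$ of $\Sigma$ (the normals given above are of this kind). *)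

(* Defs.v *)
From HB Require Import structures.
From mathcomp Require Import all_boot all_order all_algebra.
From mathcomp Require Import all_classical all_reals all_analysis.

Set Implicit Arguments.
Unset Strict Implicit.
Unset Printing Implicit Defensive.

Import Order.TTheory GRing.Theory Num.Theory.
Import numFieldNormedType.Exports.

Local Open Scope classical_set_scope.
Local Open Scope ring_scope.

(* Conventions.  Vectors are row vectors.  R^4 = R^3 x R is 'rV[R]_4, with the
   factor R as last coordinate.  The Riemann surface is C, seen as 'rV[R]_2 with
   z = u + i v, u = p 0 0 and v = p 0 1; it is identified with its own tangent
   spaces, so a linear operator on a tangent space is a matrix acting on the
   right, and the composite J S is the matrix product S *m J. *)

Section AmbientSpace.
Variable R : realType.
Implicit Types a b c w : 'rV[R]_4.

Definition vec4 (a b c d : R) : 'rV[R]_4 := \row_(j < 4) [:: a; b; c; d]`_j.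

Definition dot a b : R := (a *m b^T) 0 0.

(* The unit vector field d/dt of the factor R. *)
Definition dt : 'rV[R]_4 := vec4 0 0 0 1.

(* The projection R^3 x R -> R^3.  At a point w of S^2 x R, [horizontal w] is
   also the unit normal of S^2 x R in R^4. *)
Definition horizontal w : 'rV[R]_4 := w - dot w dt *: dt.

Definition S2xR : set 'rV[R]_4 :=
  [set w | dot (horizontal w) (horizontal w) = 1].

(* The frame (a, b, c) of the tangent space of S^2 x R at w is direct, S^2 being
   oriented by its outward normal. *)
Definition direct_frame w a b c : Prop :=
  0 < \det (\matrix_(i < 4) [:: horizontal w; a; b; c]`_i).

(* Images under the isometries (p, t) |-> (A p, t + h) with A in SO(3): these
   are the isometries of S^2 x R preserving the orientations of both factors.
   Here Q is the matrix diag(A, 1). *)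
Definition congruent (X Y : set 'rV[R]_4) : Prop :=
  exists (Q : 'M[R]_4) (h : R),
    [/\ Q *m Q^T = 1%:M, dt *m Q = dt, \det Q = 1 &
        Y = (fun w : 'rV[R]_4 => w *m Q + h *: dt) @` X].

End AmbientSpace.

Section Immersions.
Variable R : realType.
Implicit Types (x y N M : 'rV[R]_2 -> 'rV[R]_4) (p X Y : 'rV[R]_2).

Definition du : 'rV[R]_2 := delta_mx 0 0.
Definition dv : 'rV[R]_2 := delta_mx 0 1.

Fixpoint Ck (k : nat) x : Prop :=
  if k is k'.+1 then
    (forall p, differentiable x p) /\ (forall X, Ck k' (fun p => 'd x p X))
  else continuous x.

Definition smooth x : Prop := forall k, Ck k x.

Definition induced_metric x p X Y : R := dot ('d x p X) ('d x p Y).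

Definition conformal_immersion x : Prop :=
  [/\ smooth x, (forall p, S2xR (x p)) &
      forall p, [/\ 0 < induced_metric x p du du,
                    induced_metric x p du du = induced_metric x p dv dv &
                    induced_metric x p du dv = 0]].

Definition unit_normal x N : Prop :=
  forall p, [/\ dot (N p) (horizontal (x p)) = 0,
                forall X, dot (N p) ('d x p X) = 0,
                dot (N p) (N p) = 1 &
                direct_frame (x p) ('d x p du) ('d x p dv) (N p)].

(* The derivative of N along X for the Levi-Civita connection of S^2 x R: the
   tangential part of the derivative in R^4. *)
Definition connection x N p X : 'rV[R]_4 :=
  'd N p X - dot ('d N p X) (horizontal (x p)) *: horizontal (x p).

Definition shape_operator x N (S : 'rV[R]_2 -> 'M[R]_2) : Prop :=
  forall p X, 'd x p (X *m S p) = - connection x N p X.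

Definition angle_function N p : R := dot (N p) (dt R).

Definition vertical_field x N (T : 'rV[R]_2 -> 'rV[R]_2) : Prop :=
  forall p, 'd x p (T p) = dt R - dot (dt R) (N p) *: N p.

Definition conformal_minimal_immersion x : Prop :=
  conformal_immersion x /\
  exists N S, [/\ unit_normal x N, shape_operator x N S &
                  forall p, \tr (S p) = 0].

(* Rotation by pi/2, for any conformal metric: J du = dv and J dv = - du. *)
Definition J : 'M[R]_2 := \matrix_(i < 2) [:: dv; - du]`_i.

Definition has_data x (g : 'rV[R]_2 -> 'rV[R]_2 -> 'rV[R]_2 -> R)
    (S : 'rV[R]_2 -> 'M[R]_2) (T : 'rV[R]_2 -> 'rV[R]_2)
    (nu : 'rV[R]_2 -> R) : Prop :=
  exists N, [/\ unit_normal x N,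
                forall p X Y, g p X Y = induced_metric x p X Y,
                shape_operator x N S,
                vertical_field x N T &
                forall p, nu p = angle_function N p].

Definition conjugate_immersion x y : Prop :=
  [/\ conformal_minimal_immersion x, conformal_minimal_immersion y &
      exists g S T nu,
        has_data x g S T nu /\
        has_data y g (fun p => S p *m J) (fun p => T p *m J) nu].

Definition conjugate_surface x (Sigma : set 'rV[R]_4) : Prop :=
  exists2 y, conjugate_immersion x y & congruent (range y) Sigma.

End Immersions.

Section HelicoidsUnduloids.
Variable R : realType.

Definition helicoid_profile (beta : R) (phi : R -> R) : Prop :=
  [/\ forall u : R, derivable phi u 1 /\ derivable (derive1 phi) u 1,
      forall u : R, derive1 phi u ^+ 2 = 1 + beta ^+ 2 * sin (phi u) ^+ 2,
      forall u : R, derive1 (derive1 phi) u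
        = beta ^+ 2 * sin (phi u) * cos (phi u),
      phi 0 = 0 &
      forall u : R, 0 < derive1 phi u].

Definition helicoid_immersion (beta : R) (phi : R -> R) (p : 'rV[R]_2) :
    'rV[R]_4 :=
  let u := p 0 0 in let v := p 0 1 in
  vec4 (sin (phi u) * cos (beta * v)) (sin (phi u) * sin (beta * v))
       (cos (phi u)) v.

Definition helicoid (beta : R) (phi : R -> R) : set 'rV[R]_4 :=
  range (helicoid_immersion beta phi).

Definition unduloid_profile (alpha : R) (psi : R -> R) : Prop :=
  [/\ forall u : R, derivable psi u 1 /\ derivable (derive1 psi) u 1,
      forall u : R, 1 + derive1 psi u ^+ 2 = alpha ^+ 2 * sin (psi u) ^+ 2,
      forall u : R, derive1 (derive1 psi) u
        = alpha ^+ 2 * sin (psi u) * cos (psi u),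
      derive1 psi 0 = 0 &
      (forall u : R, 0 < psi u < pi) /\ 0 < cos (psi 0)].

Definition unduloid_immersion (alpha : R) (psi : R -> R) (p : 'rV[R]_2) :
    'rV[R]_4 :=
  let u := p 0 0 in let v := p 0 1 in
  vec4 (sin (psi u) * cos (alpha * v)) (sin (psi u) * sin (alpha * v))
       (cos (psi u)) u.

End HelicoidsUnduloids.

(* Main.v *)
From HB Require Import structures.
Require Import Defs.
From mathcomp Require Import all_boot all_order all_algebra.
From mathcomp Require Import all_classical all_reals all_analysis.
From mathcomp Require Import ring lra.

(* Both surfaces are of the form
     (sin f(u) cos av, sin f(u) sin av, cos f(u), b u + c v),
   with (b, c) = (1, 0) for the unduloid and (0, 1) for the helicoid, and the
   profile satisfies f'^2 + b^2 = a^2 sin^2 f + c^2 =: L, f'' = a^2 sin f cos f.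
   The immersion is conformal with factor L, and with the moving frame of
   S^2 x R adapted to the rotations one finds
     S = (a cos f / L) [[-b, -c], [-c, b]],   T = (b, c) / L,
     nu = a f' sin f / L.
   Multiplication by J turns the pattern (1, 0) into (0, 1), so that the helicoid
   itself is the conjugate immersion as soon as
     phi' = |alpha| sin psi,  |beta| sin phi = psi',
     |beta| cos phi = |alpha| cos psi.
   Both sides of these identities solve the differential system of the Jacobi
   functions with the same initial values. *)

Set Implicit Arguments.
Unset Strict Implicit.
Unset Printing Implicit Defensive.

Import Order.TTheory GRing.Theory Num.Theory.
Import numFieldNormedType.Exports.

Local Open Scope ring_scope.

(** * Differential calculus in two variables *)

(** This is a total differential, not just a pair of partial derivatives: [smooth] and all the
    geometric data are expressed through ['d], which needs differentiability. *)
Definition has_partials (R : realType) (F : 'rV[R]_2 -> R) p (A B : R) : Prop :=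
  is_diff p F (fun X => X 0 0 * A + X 0 1 * B).

Lemma has_partials_cst (R : realType) (a : R) p : has_partials (fun=> a) p 0 0.
Proof.
apply: (@is_diff_eq _ _ _ _ _ _ _ (is_diff_cst a p)).
by apply/funext => X /=; rewrite !mulr0 addr0.
Qed.

Lemma has_partialsD (R : realType) (F G : 'rV[R]_2 -> R) p A B A' B' :
  has_partials F p A B -> has_partials G p A' B' ->
  has_partials (fun q => F q + G q) p (A + A') (B + B').
Proof.
move=> dF dG; apply: (is_diff_eq (is_diffD dF dG)).
by apply/funext => X; rewrite !fctE; ring.
Qed.

Lemma has_partialsN (R : realType) (F : 'rV[R]_2 -> R) p A B :
  has_partials F p A B -> has_partials (fun q => - F q) p (- A) (- B).
Proof.
move=> dF; apply: (is_diff_eq (is_diffN dF)).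
by apply/funext => X; rewrite !fctE; ring.
Qed.

Lemma has_partialsM (R : realType) (F G : 'rV[R]_2 -> R) p A B A' B' :
  has_partials F p A B -> has_partials G p A' B' ->
  has_partials (fun q => F q * G q) p (A * G p + F p * A') (B * G p + F p * B').
Proof.
move=> dF dG; apply: (is_diff_eq (is_diffM dF dG)).
apply/funext => X; rewrite !fctE.
rewrite /GRing.scale/=; ring.
Qed.

(** A coordinate is linear and continuous, hence its own differential. *)
Lemma is_diff_coord (R : realType) m n (M : 'M[R]_(m.+1, n.+1)) i j :
  is_diff M (fun N : 'M[R]_(m.+1, n.+1) => N i j) (fun N => N i j).
Proof.
pose c (N : 'M[R]_(m.+1, n.+1)) : R := N i j.
have lin : linear c by move=> k N N'; rewrite /c !mxE.
pose cM := GRing.isLinear.Build _ _ _ _ _ lin.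
pose cL : {linear _ -> _} := HB.pack c cM.
apply: DiffDef; first exact: differentiable_coord.
by apply: (@diff_lin _ _ _ cL); exact: coord_continuous.
Qed.

Lemma is_derive_mull (R : realType) (a x : R) : is_derive x 1 ( *%R a) a.
Proof.
by apply: (is_derive_eq (is_deriveZ a (is_derive_id x 1))); exact: mulr1.
Qed.

Lemma is_derive_div (R : realType) (g h : R -> R) (u dg dh : R) :
  h u != 0 -> is_derive u 1 g dg -> is_derive u 1 h dh ->
  is_derive u 1 (fun x => g x / h x) ((dg * h u - g u * dh) / h u ^+ 2).
Proof.
move=> h0 Dg Dh; apply: (is_derive_eq (is_deriveM Dg (is_deriveV h0 Dh))).
by rewrite /GRing.scale /=; field.
Qed.

Lemma is_diff_derive1 (R : realType) (f : R -> R) (x d : R) :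
  is_derive x 1 f d -> is_diff x f (fun h => h * d : R).
Proof.
move=> df; have dx : derivable f x 1 by [].
apply: DiffDef; first exact/derivable1_diffP.
by rewrite deriv1E // derive1E derive_val.
Qed.

Lemma has_partials_u (R : realType) (f : R -> R) (p : 'rV[R]_2) d :
  is_derive (p 0 0) 1 f d -> has_partials (fun q => f (q 0 0)) p d 0.
Proof.
move=> df; apply: (is_diff_eq (is_diff_comp (is_diff_coord p 0 0) (is_diff_derive1 df))).
by apply/funext => X; rewrite fctE /= mulr0 addr0.
Qed.

Lemma has_partials_v (R : realType) (f : R -> R) (p : 'rV[R]_2) d :
  is_derive (p 0 1) 1 f d -> has_partials (fun q => f (q 0 1)) p 0 d.
Proof.
move=> df; apply: (is_diff_eq (is_diff_comp (is_diff_coord p 0 1) (is_diff_derive1 df))).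
by apply/funext => X; rewrite fctE /= mulr0 add0r.
Qed.

Lemma vec4E (R : realType) (a b c d : R) :
  vec4 a b c d = a *: vec4 1 0 0 0 + b *: vec4 0 1 0 0 + c *: vec4 0 0 1 0
                 + d *: vec4 0 0 0 1.
Proof.
apply/rowP => -[[|[|[|[|//]]]] lti]; rewrite !mxE /=; ring.
Qed.

(** Expanding along the constant basis of R^4 reduces the map to scalar functions times fixed
    vectors. *)
Lemma is_diff_vec4 (R : realType) (x1 x2 x3 x4 : 'rV[R]_2 -> R) p
    (A1 A2 A3 A4 B1 B2 B3 B4 : R) :
  has_partials x1 p A1 B1 -> has_partials x2 p A2 B2 ->
  has_partials x3 p A3 B3 -> has_partials x4 p A4 B4 ->
  is_diff p (fun q => vec4 (x1 q) (x2 q) (x3 q) (x4 q))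
    (fun X => X 0 0 *: vec4 A1 A2 A3 A4 + X 0 1 *: vec4 B1 B2 B3 B4).
Proof.
move=> d1 d2 d3 d4.
rewrite (_ : (fun q => _) = fun q => x1 q *: vec4 1 0 0 0 + x2 q *: vec4 0 1 0 0
  + x3 q *: vec4 0 0 1 0 + x4 q *: vec4 0 0 0 1); last first.
  by apply/funext => q; rewrite vec4E.
have dZ F A B (w : 'rV[R]_4) : has_partials F p A B ->
    is_diff p (fun q => F q *: w) (fun X => (X 0 0 * A + X 0 1 * B) *: w).
  move=> [dF dFE]; apply: DiffDef; first exact: differentiableZl.
  by rewrite diffZl // dFE.
apply: (is_diff_eq (is_diffD (is_diffD (is_diffD (dZ _ _ _ _ d1) (dZ _ _ _ _ d2))
  (dZ _ _ _ _ d3)) (dZ _ _ _ _ d4))).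
apply/funext => X; rewrite !fctE.
apply/rowP => -[[|[|[|[|//]]]] lti]; rewrite !mxE /=; ring.
Qed.

(** * Coordinates in R^4: scalar product, horizontal part, determinant *)

Lemma dot_vec4 (R : realType) (a b c d a' b' c' d' : R) :
  dot (vec4 a b c d) (vec4 a' b' c' d') = a * a' + b * b' + c * c' + d * d'.
Proof.
by rewrite /dot mxE !big_ord_recr big_ord0 /= !mxE /= add0r.
Qed.

Lemma horizontal_vec4 (R : realType) (a b c d : R) :
  horizontal (vec4 a b c d) = vec4 a b c 0.
Proof.
rewrite /horizontal /dt dot_vec4.
apply/rowP => -[[|[|[|[|//]]]] lti]; rewrite !mxE /=; ring.
Qed.

Lemma vec4D (R : realType) (a b c d a' b' c' d' : R) :
  vec4 a b c d + vec4 a' b' c' d' = vec4 (a + a') (b + b') (c + c') (d + d').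
Proof. by apply/rowP => -[[|[|[|[|//]]]] lti]; rewrite !mxE. Qed.

Lemma vec4N (R : realType) (a b c d : R) :
  - vec4 a b c d = vec4 (- a) (- b) (- c) (- d).
Proof. by apply/rowP => -[[|[|[|[|//]]]] lti]; rewrite !mxE. Qed.

Lemma vec4Z (R : realType) (k a b c d : R) :
  k *: vec4 a b c d = vec4 (k * a) (k * b) (k * c) (k * d).
Proof. by apply/rowP => -[[|[|[|[|//]]]] lti]; rewrite !mxE. Qed.

Lemma det_vec4 (R : realType) (a1 a2 a3 a4 b1 b2 b3 b4 c1 c2 c3 c4 d1 d2 d3 d4 : R) :
  \det (\matrix_(i < 4) [:: vec4 a1 a2 a3 a4; vec4 b1 b2 b3 b4; vec4 c1 c2 c3 c4;
                            vec4 d1 d2 d3 d4]`_i) =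
    (a1 * b2 - a2 * b1) * (c3 * d4 - c4 * d3)
  - (a1 * b3 - a3 * b1) * (c2 * d4 - c4 * d2)
  + (a1 * b4 - a4 * b1) * (c2 * d3 - c3 * d2)
  + (a2 * b3 - a3 * b2) * (c1 * d4 - c4 * d1)
  - (a2 * b4 - a4 * b2) * (c1 * d3 - c3 * d1)
  + (a3 * b4 - a4 * b3) * (c1 * d2 - c2 * d1).
Proof.
rewrite (expand_det_row _ 0) !big_ord_recr big_ord0 /= /cofactor.
rewrite !(expand_det_row _ 0) !big_ord_recr !big_ord0 /= /cofactor.
rewrite !(expand_det_row _ 0) !big_ord_recr !big_ord0 /= /cofactor.
rewrite !det_mx11 !mxE /=.
rewrite /bump /=.
ring.
Qed.

(** With [Q] the moving frame, the determinant of four vectors becomes that of their moving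
    coordinates times [\det Q]. *)
Lemma matrix4_mull (R : realType) (a b c d : 'rV[R]_4) (Q : 'M[R]_4) :
  \matrix_(i < 4) [:: a *m Q; b *m Q; c *m Q; d *m Q]`_i =
  (\matrix_(i < 4) [:: a; b; c; d]`_i) *m Q.
Proof.
by apply/row_matrixP => -[[|[|[|[|//]]]] lti];
  rewrite row_mul !rowK.
Qed.

(** * Iterated partial derivatives and smoothness *)

Fixpoint has_partials_upto (R : realType) k (F : 'rV[R]_2 -> R) : Prop :=
  if k is k'.+1 then exists A B, [/\ forall p, has_partials F p (A p) (B p),
    has_partials_upto k' A & has_partials_upto k' B] else True.

Lemma has_partials_upto_cst (R : realType) k (a : R) :
  has_partials_upto k (fun=> a).
Proof.
elim: k a => //= k IH a; exists (fun=> 0), (fun=> 0).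
by split=> // p; exact: has_partials_cst.
Qed.

Lemma has_partials_uptoW (R : realType) k (F : 'rV[R]_2 -> R) :
  has_partials_upto k.+1 F -> has_partials_upto k F.
Proof.
elim: k F => // k IH F [A [B [dF dA dB]]]; exists A, B.
by split=> //; exact: IH.
Qed.

Lemma has_partials_uptoD (R : realType) k (F G : 'rV[R]_2 -> R) :
  has_partials_upto k F -> has_partials_upto k G ->
  has_partials_upto k (fun q => F q + G q).
Proof.
elim: k F G => //= k IH F G [A [B [dF dA dB]]] [A' [B' [dG dA' dB']]].
exists (fun q => A q + A' q), (fun q => B q + B' q).
by split=> [p||]; [exact: has_partialsD | exact: IH | exact: IH].
Qed.

Lemma has_partials_uptoM (R : realType) k (F G : 'rV[R]_2 -> R) :
  has_partials_upto k F -> has_partials_upto k G ->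
  has_partials_upto k (fun q => F q * G q).
Proof.
elim: k F G => // k IH F G kF kG.
(* The Leibniz rule contains [F] and [G] themselves beside their partial derivatives, so both are
   also needed at the lower order. *)
have [kF' kG'] := (has_partials_uptoW kF, has_partials_uptoW kG).
case: kF kG => [A [B [dF dA dB]]] [A' [B' [dG dA' dB']]].
exists (fun q => A q * G q + F q * A' q), (fun q => B q * G q + F q * B' q).
by split=> [p||]; [exact: has_partialsM | |];
  apply: has_partials_uptoD; exact: IH.
Qed.

(** Order zero of [has_partials_upto] is vacuous; the one extra order supplies the continuity
    required by [Ck 0]. For fixed [X], the differential is a combination of the partial derivatives
    with constant coefficients, so the induction applies to it. *)
Lemma Ck_vec4 (R : realType) k (x1 x2 x3 x4 : 'rV[R]_2 -> R) :
  has_partials_upto k.+1 x1 -> has_partials_upto k.+1 x2 ->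
  has_partials_upto k.+1 x3 -> has_partials_upto k.+1 x4 ->
  Ck k (fun q => vec4 (x1 q) (x2 q) (x3 q) (x4 q)).
Proof.
elim: k x1 x2 x3 x4 => [|k IH] x1 x2 x3 x4 [A1 [B1 [d1 a1 b1]]]
    [A2 [B2 [d2 a2 b2]]] [A3 [B3 [d3 a3 b3]]] [A4 [B4 [d4 a4 b4]]];
  have dx p := is_diff_vec4 (d1 p) (d2 p) (d3 p) (d4 p).
  by move=> p; apply: differentiable_continuous.
split=> [p|X]; first exact: ex_diff.
under eq_fun do rewrite diff_val !vec4Z vec4D.
by apply: IH; apply: has_partials_uptoD; apply: has_partials_uptoM => //;
  exact: has_partials_upto_cst.
Qed.

Lemma smooth_vec4 (R : realType) (x1 x2 x3 x4 : 'rV[R]_2 -> R) :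
  (forall k, has_partials_upto k x1) -> (forall k, has_partials_upto k x2) ->
  (forall k, has_partials_upto k x3) -> (forall k, has_partials_upto k x4) ->
  smooth (fun q => vec4 (x1 q) (x2 q) (x3 q) (x4 q)).
Proof. by move=> *; move=> k; exact: Ck_vec4. Qed.

(** Up to constant factors sine and cosine are each other's derivatives, hence a joint induction. *)
Lemma has_partials_upto_sincos (R : realType) (a : R) k :
  has_partials_upto k (fun q => sin (a * q 0 1)) /\
  has_partials_upto k (fun q => cos (a * q 0 1)).
Proof.
elim: k => // k [IHs IHc].
have da (x : R) : is_derive x 1 ( *%R a) a by exact: is_derive_mull.
split; do 2 eexists; split.
- move=> p; apply: (@has_partials_v _ (sin \o *%R a)); exact: is_derive1_comp.
- exact: has_partials_upto_cst.
- by apply: has_partials_uptoM => //; exact: has_partials_upto_cst.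
- move=> p; apply: (@has_partials_v _ (cos \o *%R a)); exact: is_derive1_comp.
- exact: has_partials_upto_cst.
- under eq_fun do rewrite mulNr -mulrN.
  by apply: has_partials_uptoM => //; exact: has_partials_upto_cst.
Qed.

(* The ring generated by sin f, cos f, f' is stable under differentiation. *)
Lemma has_partials_upto_pendulum (R : realType) (a : R) (f : R -> R) k :
  (forall u, derivable f u 1 /\ derivable (derive1 f) u 1) ->
  (forall u, derive1 (derive1 f) u = a ^+ 2 * sin (f u) * cos (f u)) ->
  [/\ has_partials_upto k (fun q => sin (f (q 0 0))),
      has_partials_upto k (fun q => cos (f (q 0 0))) &
      has_partials_upto k (fun q => derive1 f (q 0 0))].
Proof.
move=> df ddf; elim: k => // k [IHs IHc IHf].
have D1 (u : R) : is_derive u 1 f (derive1 f u).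
  by rewrite derive1E; apply: derivableP; exact: (df u).1.
have D2 (u : R) : is_derive u 1 (derive1 f) (a ^+ 2 * sin (f u) * cos (f u)).
  by rewrite -ddf derive1E; apply: derivableP; exact: (df u).2.
have Hc b := @has_partials_upto_cst R k b.
split; do 2 eexists; split.
- move=> p; apply: (@has_partials_u _ (sin \o f)); exact: is_derive1_comp.
- exact: has_partials_uptoM.
- exact: Hc.
- move=> p; apply: (@has_partials_u _ (cos \o f)); exact: is_derive1_comp.
- under eq_fun do rewrite mulNr -mulrN -mulN1r mulrC.
  by do 2 apply: has_partials_uptoM => //.
- exact: Hc.
- by move=> p; apply: has_partials_u.
- by do 2 apply: has_partials_uptoM => //.
- exact: Hc.
Qed.

Lemma has_partials_upto_coord (R : realType) k (j : 'I_2) :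
  has_partials_upto k (fun q : 'rV[R]_2 => q 0 j).
Proof.
case: k => // k.
have C b := @has_partials_upto_cst R k b.
have [->|->] : j = 0 \/ j = 1.
  by case: j => [[|[|//]]] ltj; [left|right]; apply/val_inj.
- exists (fun=> 1), (fun=> 0); split=> // p.
  exact: (@has_partials_u _ id).
- exists (fun=> 0), (fun=> 1); split=> // p.
  exact: (@has_partials_v _ id).
Qed.

(** * The moving frame *)

(* The rows are the outward normal of S^2 at the point of colatitude th and
   longitude t, the unit vectors along the meridian and the parallel, and d/dt. *)
Definition rotating_frame (R : realType) (th t : R) : 'M[R]_4 :=
  \matrix_(i < 4) [:: vec4 (sin th * cos t) (sin th * sin t) (cos th) 0;
                      vec4 (cos th * cos t) (cos th * sin t) (- sin th) 0;
                      vec4 (- sin t) (cos t) 0 0;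
                      vec4 0 0 0 1]`_i.

Lemma mul_rotating_frame (R : realType) (th t a b c d : R) :
  vec4 a b c d *m rotating_frame th t =
  vec4 (a * sin th * cos t + b * cos th * cos t - c * sin t)
       (a * sin th * sin t + b * cos th * sin t + c * cos t)
       (a * cos th - b * sin th) d.
Proof.
by apply/rowP => -[[|[|[|[|//]]]] lti];
  rewrite !mxE !big_ord_recr big_ord0 /= !mxE /= ?mxE /=; ring.
Qed.

Lemma rotating_frame_orthogonal (R : realType) (th t : R) :
  rotating_frame th t *m (rotating_frame th t)^T = 1%:M.
Proof.
have Eth : sin th ^+ 2 = 1 - cos th ^+ 2 by exact: sin2cos2.
(* The entries are treated as linear expressions in their monomials, so each multiple of sin^2 t = 1
   - cos^2 t that occurs is listed. *)
have Et k : k * sin t ^+ 2 = k * (1 - cos t ^+ 2) by rewrite sin2cos2.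
have := (Et 1, Et (sin th ^+ 2), Et (cos th ^+ 2), Et (sin th * cos th)).
move=> [[[E1 E2] E3] E4]; apply/matrixP => -[[|[|[|[|//]]]] lti] [[|[|[|[|//]]]] ltj];
  rewrite !mxE !big_ord_recr big_ord0 /= !mxE /= ?mxE /=; lra.
Qed.

Lemma dot_rotating_frame (R : realType) (th t : R) (x y : 'rV[R]_4) :
  dot (x *m rotating_frame th t) (y *m rotating_frame th t) = dot x y.
Proof.
by rewrite /dot trmx_mul mulmxA -(mulmxA x) rotating_frame_orthogonal mulmx1.
Qed.

Lemma det_rotating_frame (R : realType) (th t : R) :
  \det (rotating_frame th t) = 1.
Proof.
have Eth : sin th ^+ 2 = 1 - cos th ^+ 2 by exact: sin2cos2.
have Et : sin t ^+ 2 = 1 - cos t ^+ 2 by exact: sin2cos2.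
rewrite det_vec4.
transitivity ((sin th ^+ 2 + cos th ^+ 2) * (sin t ^+ 2 + cos t ^+ 2)); first by ring.
by rewrite Eth Et !subrK mulr1.
Qed.

(** Structure equations of the frame. Write e0, e1, e2 for its first three rows. Along u, e0 varies
    by f' e1 and e1 by - f' e0. Along v, e0 and e1 vary by a sin f e2 and a cos f e2, and e2 by - a
    (sin f e0 + cos f e1). Only the vertical coefficient may depend on both variables, which covers
    both the immersion and its normal. *)
Lemma is_diff_rotating_frame (R : realType) (f w0 w1 w2 : R -> R)
    (w3 : 'rV[R]_2 -> R) (a : R) (p : 'rV[R]_2) (df d0 d1 d2 A B : R) :
  is_derive (p 0 0) 1 f df -> is_derive (p 0 0) 1 w0 d0 ->
  is_derive (p 0 0) 1 w1 d1 -> is_derive (p 0 0) 1 w2 d2 ->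
  has_partials w3 p A B ->
  is_diff p (fun q => vec4 (w0 (q 0 0)) (w1 (q 0 0)) (w2 (q 0 0)) (w3 q)
                        *m rotating_frame (f (q 0 0)) (a * q 0 1))
    (fun X => (X 0 0 *: vec4 (d0 - df * w1 (p 0 0)) (d1 + df * w0 (p 0 0)) d2 A
               + X 0 1 *: (vec4 (- (a * sin (f (p 0 0)) * w2 (p 0 0)))
                     (- (a * cos (f (p 0 0)) * w2 (p 0 0)))
                     (a * (sin (f (p 0 0)) * w0 (p 0 0)
                           + cos (f (p 0 0)) * w1 (p 0 0))) B))
              *m rotating_frame (f (p 0 0)) (a * p 0 1)).
Proof.
move=> Df D0 D1 D2 D3.
have Hs : has_partials (fun q => sin (f (q 0 0))) p (cos (f (p 0 0)) * df) 0.
  by apply: (@has_partials_u _ (sin \o f)); apply: is_derive1_comp.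
have Hc : has_partials (fun q => cos (f (q 0 0))) p (- sin (f (p 0 0)) * df) 0.
  by apply: (@has_partials_u _ (cos \o f)); apply: is_derive1_comp.
have Hsv : has_partials (fun q => sin (a * q 0 1)) p 0 (cos (a * p 0 1) * a).
  apply: (@has_partials_v _ (sin \o ( *%R a))); apply: is_derive1_comp.
  exact: is_derive_mull.
have Hcv : has_partials (fun q => cos (a * q 0 1)) p 0 (- sin (a * p 0 1) * a).
  apply: (@has_partials_v _ (cos \o ( *%R a))); apply: is_derive1_comp.
  exact: is_derive_mull.
have H0 := has_partials_u D0; have H1 := has_partials_u D1.
have H2 := has_partials_u D2.
under eq_fun do rewrite mul_rotating_frame.
apply: is_diff_eq.
  apply: is_diff_vec4.
  all: do ?[eassumption | apply: has_partialsD | apply: has_partialsM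
    | apply: has_partialsN].
have E k : k * sin (f (p 0 0)) ^+ 2 = k * (1 - cos (f (p 0 0)) ^+ 2).
  by rewrite sin2cos2.
have := (E (a * w2 (p 0 0) * cos (a * p 0 1)), E (a * w2 (p 0 0) * sin (a * p 0 1))).
move=> [E1 E2].
apply/funext => X.
rewrite mulmxDl -!scalemxAl !mul_rotating_frame.
congr (_ *: _ + _ *: _).
  apply/rowP => -[[|[|[|[|//]]]] lti]; rewrite !mxE /=; ring.
apply/rowP => -[[|[|[|[|//]]]] lti]; rewrite !mxE /=; lra.
Qed.

(** * Geometry of the screw surfaces *)

Definition screw_immersion (R : realType) (a b c : R) (f : R -> R)
    (p : 'rV[R]_2) : 'rV[R]_4 :=
  vec4 (sin (f (p 0 0)) * cos (a * p 0 1)) (sin (f (p 0 0)) * sin (a * p 0 1))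
    (cos (f (p 0 0))) (b * p 0 0 + c * p 0 1).

(* The last two conditions mean that (b, c) is (+-1, 0) or (0, +-1). *)
Definition screw_profile (R : realType) (a b c : R) (f : R -> R) : Prop :=
  [/\ forall u, derivable f u 1 /\ derivable (derive1 f) u 1,
      forall u, derive1 f u ^+ 2 + b ^+ 2 = a ^+ 2 * sin (f u) ^+ 2 + c ^+ 2,
      forall u, derive1 (derive1 f) u = a ^+ 2 * sin (f u) * cos (f u),
      b * c = 0 & b ^+ 2 + c ^+ 2 = 1].

Lemma smooth_screw (R : realType) (a b c : R) (f : R -> R) :
  screw_profile a b c f -> smooth (screw_immersion a b c f).
Proof.
move=> [df _ ddf _ _].
have H k := has_partials_upto_pendulum k df ddf.
have K k := has_partials_upto_sincos a k.
apply: smooth_vec4 => k; case: (H k) => hs hc _; case: (K k) => ks kc.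
- exact: has_partials_uptoM.
- exact: has_partials_uptoM.
- exact: hc.
- by apply: has_partials_uptoD; apply: has_partials_uptoM;
    by [exact: has_partials_upto_cst | exact: has_partials_upto_coord].
Qed.

(** Here [P] stands for f', [Q] for a sin f and [L] for the conformal factor. Everything follows
    from P^2 = L - b^2 and Q^2 = L - c^2, and positivity from 2 L = P^2 + Q^2 + 1. These relations
    treat the two surfaces at once, without separating the values of (b, c). *)
Lemma screw_relations (R : realType) (P Q b c : R) :
  P ^+ 2 + b ^+ 2 = Q ^+ 2 + c ^+ 2 -> b * c = 0 -> b ^+ 2 + c ^+ 2 = 1 ->
  let L := P ^+ 2 + b ^+ 2 in
  [/\ 0 < L, b * Q ^+ 2 = b * L, c * P ^+ 2 = c * L,
      P ^+ 2 + Q ^+ 2 = 2 * L - 1 & P ^+ 2 * Q ^+ 2 = L ^+ 2 - L].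
Proof.
move=> E bc0 bc1 L.
have EQ : Q ^+ 2 = L - c ^+ 2 by rewrite /L E addrK.
have EP : P ^+ 2 = L - b ^+ 2 by rewrite /L addrK.
split.
- have := sqr_ge0 P; have := sqr_ge0 Q; rewrite EP EQ; lra.
- rewrite EQ mulrBr (_ : b * c ^+ 2 = b * c * c); last by ring.
  by rewrite bc0 mul0r subr0.
- rewrite EP mulrBr (_ : c * b ^+ 2 = b * c * b); last by ring.
  by rewrite bc0 mul0r subr0.
- by rewrite EP EQ; lra.
- rewrite EP EQ.
  rewrite (_ : (L - b ^+ 2) * (L - c ^+ 2)
    = L ^+ 2 - L * (b ^+ 2 + c ^+ 2) + (b * c) ^+ 2); last by ring.
  by rewrite bc0 bc1; ring.
Qed.

Definition screw_factor (R : realType) (b : R) (f : R -> R) (u : R) : R :=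
  derive1 f u ^+ 2 + b ^+ 2.

(** In the last three frame vectors the coordinate tangent vectors are (P, 0, b) and (0, Q, c), with
    P = f' and Q = a sin f; the normal is their cross product (- b Q, - c P, P Q) divided by
    [screw_factor]. *)
Definition screw_normal (R : realType) (a b c : R) (f : R -> R)
    (p : 'rV[R]_2) : 'rV[R]_4 :=
  let u := p 0 0 in
  vec4 0 (- (b * (a * sin (f u))) / screw_factor b f u)
         (- (c * derive1 f u) / screw_factor b f u)
         (derive1 f u * (a * sin (f u)) / screw_factor b f u)
    *m rotating_frame (f u) (a * p 0 1).

Definition screw_shape (R : realType) (a b c : R) (f : R -> R)
    (p : 'rV[R]_2) : 'M[R]_2 :=
  (a * cos (f (p 0 0)) / screw_factor b f (p 0 0)) *:
    \matrix_(i < 2) [:: - b *: du R - c *: dv R; - c *: du R + b *: dv R]`_i.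

Definition screw_vertical (R : realType) (b c : R) (f : R -> R)
    (p : 'rV[R]_2) : 'rV[R]_2 :=
  (screw_factor b f (p 0 0))^-1 *: (b *: du R + c *: dv R).

Lemma screw_immersionE (R : realType) (a b c : R) (f : R -> R) :
  screw_immersion a b c f =
  fun q => vec4 1 0 0 (b * q 0 0 + c * q 0 1)
             *m rotating_frame (f (q 0 0)) (a * q 0 1).
Proof.
apply/funext => q; rewrite mul_rotating_frame /screw_immersion.
by congr vec4; ring.
Qed.

Lemma vec4_dt (R : realType) th t : vec4 0 0 0 1 *m rotating_frame th t = dt R.
Proof. by rewrite mul_rotating_frame /dt; congr vec4; ring. Qed.

Lemma horizontal_screw (R : realType) (a b c : R) (f : R -> R) p :
  horizontal (screw_immersion a b c f p)
  = vec4 1 0 0 0 *m rotating_frame (f (p 0 0)) (a * p 0 1).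
Proof.
by rewrite horizontal_vec4 mul_rotating_frame; congr vec4; ring.
Qed.

Lemma is_diff_screw (R : realType) (a b c : R) (f : R -> R) (p : 'rV[R]_2) :
  derivable f (p 0 0) 1 ->
  is_diff p (screw_immersion a b c f)
    (fun X => (X 0 0 *: vec4 0 (derive1 f (p 0 0)) 0 b
               + X 0 1 *: vec4 0 0 (a * sin (f (p 0 0))) c)
              *m rotating_frame (f (p 0 0)) (a * p 0 1)).
Proof.
move=> df; rewrite screw_immersionE.
have Df : is_derive (p 0 0) 1 f (derive1 f (p 0 0)).
  by rewrite derive1E; apply: derivableP.
have D (k : R) : is_derive (p 0 0) 1 (fun=> k) 0 by exact: is_derive_cst.
have Dc k : has_partials (fun=> k) p 0 0 by exact: has_partials_cst.
have D3 := has_partialsD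
  (has_partialsM (Dc b) (has_partials_u (is_derive_id (p 0 0) 1)))
  (has_partialsM (Dc c) (has_partials_v (is_derive_id (p 0 1) 1))).
apply: (is_diff_eq (is_diff_rotating_frame a Df (D _) (D _) (D _) D3)).
by apply/funext => X; congr ((_ *: _ + _ *: _) *m _); congr vec4; ring.
Qed.

(** The profile equation gives P' = C Q, Q' = C P and L' = 2 C P Q; after the quotient rule,
    [screw_relations] lowers the denominators from L^2 to L. The first frame coordinate is the
    component normal to S^2 x R, which [connection] discards. *)
Lemma is_diff_screw_normal (R : realType) (a b c : R) (f : R -> R)
    (p : 'rV[R]_2) :
  screw_profile a b c f ->
  let P := derive1 f (p 0 0) in let Q := a * sin (f (p 0 0)) in
  let C := a * cos (f (p 0 0)) in let L := screw_factor b f (p 0 0) in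
  is_diff p (screw_normal a b c f)
    (fun X => (X 0 0 *: vec4 (P * (b * Q) / L) (C / L * (b * P))
                             (C / L * (c * Q)) (C / L)
               + X 0 1 *: vec4 (Q * (c * P) / L) (C / L * (c * P))
                             (- (C / L * (b * Q))) 0)
              *m rotating_frame (f (p 0 0)) (a * p 0 1)).
Proof.
move=> [df eqf ddf bc0 bc1] P Q C L.
have [L0 bQ cP PQ2 PQ] : [/\ 0 < L, b * Q ^+ 2 = b * L, c * P ^+ 2 = c * L,
      P ^+ 2 + Q ^+ 2 = 2 * L - 1 & P ^+ 2 * Q ^+ 2 = L ^+ 2 - L].
  by apply: screw_relations => //; rewrite exprMn.
have {}L0 : L != 0 by rewrite gt_eqF.
set u := p 0 0 in P Q C L L0 bQ cP PQ2 PQ *.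
have Df : is_derive u 1 f P by rewrite /P derive1E; apply: derivableP; case: (df u).
have Ddf : is_derive u 1 (derive1 f) (C * Q).
  rewrite (_ : C * Q = derive1 (derive1 f) u); last by rewrite ddf /C /Q; ring.
  by rewrite derive1E; apply: derivableP; case: (df u).
have DQ : is_derive u 1 (fun x => a * sin (f x)) (C * P).
  have Dsin : is_derive u 1 (sin \o f) (cos (f u) * P) by exact: is_derive1_comp.
  by apply: (is_derive_eq (is_deriveZ a Dsin)); rewrite /C /GRing.scale /=; ring.
have DL : is_derive u 1 (screw_factor b f) (2 * P * (C * Q)).
  apply: (is_derive_eq (is_deriveD (is_deriveX 2 Ddf) (is_derive_cst (b ^+ 2) u 1))).
  by rewrite /GRing.scale /= -/P; ring.
have D1 := is_derive_div L0 (is_deriveN (is_deriveZ b DQ)) DL.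
have D2 := is_derive_div L0 (is_deriveN (is_deriveZ c Ddf)) DL.
have D3 := has_partials_u (is_derive_div L0 (is_deriveM Ddf DQ) DL).
have D0 : is_derive u 1 (fun=> 0 : R) 0 by exact: is_derive_cst.
apply: (is_diff_eq (is_diff_rotating_frame a Df D0 D1 D2 D3)).
apply/funext => X; congr ((_ *: _ + _ *: _) *m _); congr vec4;
  rewrite ?fctE /= /GRing.scale /= -/u -/P -/Q -/L.
- by field.
- transitivity (C * P * (2 * (b * Q ^+ 2) - b * L) / L ^+ 2); first by field.
  by rewrite bQ; field.
- transitivity (C * Q * (2 * (c * P ^+ 2) - c * L) / L ^+ 2); first by field.
  by rewrite cP; field.
- transitivity (C * ((P ^+ 2 + Q ^+ 2) * L - 2 * (P ^+ 2 * Q ^+ 2)) / L ^+ 2).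
    by field.
  by rewrite PQ2 PQ; field.
- by field.
- by rewrite -/C; field.
- by rewrite /C; field.
Qed.

Lemma diff_screw (R : realType) (a b c : R) (f : R -> R) (p X : 'rV[R]_2) :
  screw_profile a b c f ->
  'd (screw_immersion a b c f) p X =
  vec4 0 (X 0 0 * derive1 f (p 0 0)) (X 0 1 * (a * sin (f (p 0 0))))
       (X 0 0 * b + X 0 1 * c) *m rotating_frame (f (p 0 0)) (a * p 0 1).
Proof.
move=> [df _ _ _ _]; have D := is_diff_screw a b c (df (p 0 0)).1; rewrite diff_val.
by rewrite !vec4Z vec4D; congr (vec4 _ _ _ _ *m _); ring.
Qed.

Lemma induced_metric_screw (R : realType) (a b c : R) (f : R -> R)
    (p X Y : 'rV[R]_2) :
  screw_profile a b c f ->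
  induced_metric (screw_immersion a b c f) p X Y =
  screw_factor b f (p 0 0) * (X 0 0 * Y 0 0 + X 0 1 * Y 0 1).
Proof.
move=> prof; rewrite /induced_metric !diff_screw // dot_rotating_frame dot_vec4.
case: prof => _ /(_ (p 0 0)) eqf _ bc0 _; rewrite /screw_factor.
transitivity ((derive1 f (p 0 0) ^+ 2 + b ^+ 2) * (X 0 0 * Y 0 0) +
  (a ^+ 2 * sin (f (p 0 0)) ^+ 2 + c ^+ 2) * (X 0 1 * Y 0 1) +
  b * c * (X 0 0 * Y 0 1 + X 0 1 * Y 0 0)); first by ring.
by rewrite bc0 mul0r addr0 eqf -mulrDr.
Qed.

Lemma screw_factor_gt0 (R : realType) (a b c : R) (f : R -> R) (u : R) :
  screw_profile a b c f -> 0 < screw_factor b f u.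
Proof.
move=> [_ /(_ u) eqf _ bc0 bc1].
have H : derive1 f u ^+ 2 + b ^+ 2 = (a * sin (f u)) ^+ 2 + c ^+ 2 by rewrite exprMn.
by case: (screw_relations H bc0 bc1).
Qed.

Lemma conformal_screw (R : realType) (a b c : R) (f : R -> R) :
  screw_profile a b c f -> conformal_immersion (screw_immersion a b c f).
Proof.
move=> prof; split=> [|p|p]; first exact: smooth_screw prof.
  by rewrite /S2xR /= horizontal_screw dot_rotating_frame dot_vec4; ring.
rewrite !induced_metric_screw // !mxE /= !(mulr0, mul0r, addr0, add0r) !mulr1.
by split=> //; exact: screw_factor_gt0 prof.
Qed.

Lemma unit_normal_screw (R : realType) (a b c : R) (f : R -> R) :
  screw_profile a b c f ->
  unit_normal (screw_immersion a b c f) (screw_normal a b c f).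
Proof.
move=> prof p; have L0 := screw_factor_gt0 (p 0 0) prof.
rewrite /direct_frame horizontal_screw !diff_screw // !mxE /=.
rewrite /screw_normal /= !dot_rotating_frame !dot_vec4 matrix4_mull.
rewrite det_mulmx det_rotating_frame det_vec4.
have [_ /(_ (p 0 0)) eqf _ bc0 bc1] := prof.
set P := derive1 f (p 0 0); set Q := a * sin (f (p 0 0)).
have H : P ^+ 2 + b ^+ 2 = Q ^+ 2 + c ^+ 2 by rewrite exprMn.
have [_ bQ cP PQ2 PQ] := screw_relations H bc0 bc1.
rewrite -/(screw_factor b f (p 0 0)) in bQ cP PQ2 PQ.
set L := screw_factor b f (p 0 0) in L0 bQ cP PQ2 PQ *.
have {}L0' : L != 0 by rewrite gt_eqF.
(* The squared norm of the cross product (- b Q, - c P, P Q), equal to (b^2 + c^2) L + L^2 - L. *)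
have NN : b * (b * Q ^+ 2) + c * (c * P ^+ 2) + P ^+ 2 * Q ^+ 2 = L ^+ 2.
  rewrite bQ cP PQ (_ : _ + _ = (b ^+ 2 + c ^+ 2) * L + (L ^+ 2 - L)); last by ring.
  by rewrite bc1; ring.
split.
- by ring.
- move=> X; rewrite diff_screw // dot_rotating_frame dot_vec4 -/P -/Q -/L.
  by field.
- rewrite (_ : _ + _ = (b * (b * Q ^+ 2) + c * (c * P ^+ 2) + P ^+ 2 * Q ^+ 2)
    / L ^+ 2); last by field.
  by rewrite NN divff // expf_neq0.
(* The determinant is this squared norm divided by [L], that is [L] itself, which is positive. *)
- rewrite (_ : _ + _ = (b * (b * Q ^+ 2) + c * (c * P ^+ 2) + P ^+ 2 * Q ^+ 2)
    / L); last by field.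
  by rewrite NN expr2 mulfK // mulr1.
Qed.

Lemma screw_shape_mul (R : realType) (a b c : R) (f : R -> R) (p X : 'rV[R]_2) :
  let k := a * cos (f (p 0 0)) / screw_factor b f (p 0 0) in
  (X *m screw_shape a b c f p) 0 0 = - (k * (X 0 0 * b + X 0 1 * c)) /\
  (X *m screw_shape a b c f p) 0 1 = k * (X 0 1 * b - X 0 0 * c).
Proof.
have e0 : widen_ord (leqnSn 1) ord_max = 0 by apply/val_inj.
have e1 : ord_max = 1 :> 'I_2 by apply/val_inj.
by rewrite /=; split;
  rewrite !mxE !big_ord_recr big_ord0 /= !mxE /= ?mxE /= e0 e1; ring.
Qed.

Lemma shape_operator_screw (R : realType) (a b c : R) (f : R -> R) :
  screw_profile a b c f ->
  shape_operator (screw_immersion a b c f) (screw_normal a b c f)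
    (screw_shape a b c f).
Proof.
move=> prof p X; have L0 := screw_factor_gt0 (p 0 0) prof.
rewrite [LHS]diff_screw // /connection horizontal_screw.
have D := is_diff_screw_normal p prof; rewrite diff_val dot_rotating_frame.
have [-> ->] := screw_shape_mul a b c f p X.
rewrite scalemxAl -mulmxBl -mulNmx !vec4Z !vec4D dot_vec4 !vec4N vec4D vec4N.
have {}L0' : screw_factor b f (p 0 0) != 0 by rewrite gt_eqF.
have [_ _ _ bc0 bc1] := prof.
congr (vec4 _ _ _ _ *m _); [by ring | by ring | by ring |].
set k := _ / _.
(* Vertical component: the terms in b c cancel and b^2 + c^2 = 1 remains to be used. *)
transitivity (- (k * X 0 0 * (b ^+ 2 + c ^+ 2))); first by ring.
by rewrite bc1; ring.
Qed.

(** The moving coordinates of dt - nu N are 0, b Q^2 P / L^2, c P^2 Q / L^2 and 1 - P^2 Q^2 / L^2;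
    by [screw_relations] they reduce to 0, b P / L, c Q / L and 1 / L, those of (b x_u + c x_v) /
    L. *)
Lemma vertical_field_screw (R : realType) (a b c : R) (f : R -> R) :
  screw_profile a b c f ->
  vertical_field (screw_immersion a b c f) (screw_normal a b c f)
    (screw_vertical b c f).
Proof.
move=> prof p; have L0 := screw_factor_gt0 (p 0 0) prof.
rewrite diff_screw // /screw_normal /= -[in RHS](vec4_dt (f (p 0 0)) (a * p 0 1)).
rewrite dot_rotating_frame dot_vec4 scalemxAl -mulmxBl vec4Z vec4N vec4D.
rewrite /screw_vertical !mxE /=.
have [_ /(_ (p 0 0)) eqf _ bc0 bc1] := prof.
set P := derive1 f (p 0 0); set Q := a * sin (f (p 0 0)).
have H : P ^+ 2 + b ^+ 2 = Q ^+ 2 + c ^+ 2 by rewrite exprMn.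
have [_ bQ cP PQ2 PQ] := screw_relations H bc0 bc1.
rewrite -/(screw_factor b f (p 0 0)) in bQ cP PQ2 PQ.
set L := screw_factor b f (p 0 0) in L0 bQ cP PQ2 PQ *.
have {}L0' : L != 0 by rewrite gt_eqF.
congr (vec4 _ _ _ _ *m _).
- by ring.
- transitivity (b * Q ^+ 2 * P / L ^+ 2); last by field.
  by rewrite bQ; field.
- transitivity (c * P ^+ 2 * Q / L ^+ 2); last by field.
  by rewrite cP; field.
- transitivity (1 - P ^+ 2 * Q ^+ 2 / L ^+ 2); last by field.
  rewrite PQ; transitivity ((b ^+ 2 + c ^+ 2) / L); first by field.
  by rewrite bc1; field.
Qed.

Lemma angle_function_screw (R : realType) (a b c : R) (f : R -> R) p :
  angle_function (screw_normal a b c f) p =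
  derive1 f (p 0 0) * (a * sin (f (p 0 0))) / screw_factor b f (p 0 0).
Proof.
rewrite /angle_function /screw_normal /= -(vec4_dt (f (p 0 0)) (a * p 0 1)).
by rewrite dot_rotating_frame dot_vec4; ring.
Qed.

Lemma has_data_screw (R : realType) (a b c : R) (f : R -> R) :
  screw_profile a b c f ->
  has_data (screw_immersion a b c f) (induced_metric (screw_immersion a b c f))
    (screw_shape a b c f) (screw_vertical b c f)
    (angle_function (screw_normal a b c f)).
Proof.
move=> prof; exists (screw_normal a b c f); split=> //.
- exact: unit_normal_screw.
- exact: shape_operator_screw.
- exact: vertical_field_screw.
Qed.

Lemma conformal_minimal_screw (R : realType) (a b c : R) (f : R -> R) :
  screw_profile a b c f -> conformal_minimal_immersion (screw_immersion a b c f).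
Proof.
move=> prof; split; first exact: conformal_screw prof.
exists (screw_normal a b c f), (screw_shape a b c f); split=> [||p].
- exact: unit_normal_screw.
- exact: shape_operator_screw.
- by rewrite /mxtrace !big_ord_recr big_ord0 /= !mxE /= ?mxE /=; ring.
Qed.

(** * Identification of the profiles *)

(** The function f^2 exp(- 2 K u) has derivative 2 (m - K) f^2 exp(- 2 K u) <= 0 and vanishes at 0,
    so f^2 <= 0 for u >= 0. *)
Lemma gronwall_ge0 (R : realType) (f m : R -> R) (K : R) :
  (forall u : R, is_derive u 1 f (m u * f u)) -> (forall u, m u <= K) ->
  f 0 = 0 -> forall u, 0 <= u -> f u = 0.
Proof.
move=> Df mK f0 u u0.
pose h := (f ^+ 2) * (expR \o ( *%R (- (2 * K)))).
have Dh (x : R) : is_derive x 1 h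
    (2 * (m x - K) * f x ^+ 2 * expR (- (2 * K) * x)).
  have DE : is_derive x 1 (expR \o ( *%R (- (2 * K))))
      (expR (- (2 * K) * x) * - (2 * K)).
    by apply: is_derive1_comp; exact: is_derive_mull.
  apply: (is_derive_eq (is_deriveM (is_deriveX 2 (Df x)) DE)).
  by rewrite /GRing.scale /= !fctE; ring.
have : h u <= h 0.
  apply: (@ler0_derive1_nincr _ h 0 u) => //.
  - move=> x _; rewrite derive1E derive_val.
    rewrite mulr_le0_ge0 ?expR_ge0 // mulr_le0_ge0 ?sqr_ge0 //.
    by rewrite pmulr_rle0 // subr_le0.
  - exact: derivable_within_continuous.
rewrite /h !fctE f0 expr0n mul0r pmulr_lle0 ?expR_gt0 // => fu.
by apply/eqP; rewrite -sqrf_eq0 eq_le fu sqr_ge0.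
Qed.

(** Negative u is reached by the reflection u -> - u, which turns m(u) into - m(- u); hence the
    two-sided bound on [m]. *)
Lemma gronwall_eq0 (R : realType) (f m : R -> R) (K : R) :
  (forall u : R, is_derive u 1 f (m u * f u)) -> (forall u, `|m u| <= K) ->
  f 0 = 0 -> forall u, f u = 0.
Proof.
move=> Df mK f0 u; have [u0|u0] := leP 0 u.
  by apply: (gronwall_ge0 Df _ f0 u0) => x; exact: le_trans (ler_norm _) (mK x).
have Dg (x : R) : is_derive x 1 (f \o -%R) (- m (- x) * (f \o -%R) x).
  apply: (is_derive_eq (is_derive1_comp (Df (- x)) (is_deriveNid x 1))).
  by rewrite /=; ring.
have := @gronwall_ge0 _ _ (fun x => - m (- x)) K Dg _ _ (- u).
rewrite /= opprK oppr0; apply => //; last by rewrite oppr_ge0 ltW.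
by move=> x; apply: le_trans (ler_norm _) _; rewrite normrN.
Qed.

(* The triple (s, c, d) is (sn, cn, dn) for the imaginary modulus k = i beta. *)
Definition jacobi_triple (R : realType) (beta : R) (s c d : R -> R) : Prop :=
  [/\ forall u : R, is_derive u 1 s (c u * d u),
      forall u : R, is_derive u 1 c (- (s u * d u)),
      forall u, 0 < d u /\ d u ^+ 2 = 1 + beta ^+ 2 * s u ^+ 2,
      forall u, s u ^+ 2 + c u ^+ 2 = 1 & s 0 = 0 /\ c 0 = 1].

(* With s = sin x, c = cos x and s' = sin x', c' = cos x', the function F below is
   sin (x - x') and G is cos (x - x'); F solves a linear equation F' = m F. *)
Lemma jacobi_triple_unique (R : realType) (beta : R) (s c d s' c' d' : R -> R) :
  jacobi_triple beta s c d -> jacobi_triple beta s' c' d' ->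
  forall u, [/\ s u = s' u, c u = c' u & d u = d' u].
Proof.
move=> [Ds Dc dE sc1 [s0 c0]] [Ds' Dc' dE' sc1' [s0' c0']].
pose F u := s u * c' u - c u * s' u; pose G u := c u * c' u + s u * s' u.
have DF (u : R) : is_derive u 1 F ((d u - d' u) * G u).
  apply: (is_derive_eq (is_deriveB (is_deriveM (Ds u) (Dc' u))
                                   (is_deriveM (Dc u) (Ds' u)))).
  by rewrite /GRing.scale /= /G; ring.
have DG (u : R) : is_derive u 1 G (- (d u - d' u) * F u).
  apply: (is_derive_eq (is_deriveD (is_deriveM (Dc u) (Dc' u))
                                   (is_deriveM (Ds u) (Ds' u)))).
  by rewrite /GRing.scale /= /F; ring.
(* [H] is sin (x + x'), and [FH] is sin^2 x - sin^2 x' = sin (x - x') sin (x + x'). *)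
pose H u := s u * c' u + c u * s' u.
have FH u : s u ^+ 2 - s' u ^+ 2 = F u * H u.
  transitivity (s u ^+ 2 * (s' u ^+ 2 + c' u ^+ 2)
                - s' u ^+ 2 * (s u ^+ 2 + c u ^+ 2)).
    by rewrite sc1 sc1' !mulr1.
  by rewrite /F /H; ring.
have dd u : (d u - d' u) * (d u + d' u) = beta ^+ 2 * (F u * H u).
  by rewrite -FH -subr_sqr (dE u).2 (dE' u).2; ring.
have d_ge1 (x e : R) : 0 < e -> e ^+ 2 = 1 + beta ^+ 2 * x ^+ 2 -> 1 <= e.
  move=> e0 eE; rewrite -(@expr_ge1 _ 2) ?(ltW e0) // eE lerDl.
  by rewrite mulr_ge0 ?sqr_ge0.
have d1 u : 1 <= d u by apply: (d_ge1 (s u)); case: (dE u).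
have d1' u : 1 <= d' u by apply: (d_ge1 (s' u)); case: (dE' u).
have norm1 (x y : R) : x ^+ 2 + y ^+ 2 = 1 -> `|x| <= 1.
  move=> xy; rewrite -(@expr_le1 _ 2) // real_normK ?num_real //.
  by rewrite -xy lerDl sqr_ge0.
have sccs u : (s u ^+ 2 + c u ^+ 2) * (s' u ^+ 2 + c' u ^+ 2) = 1.
  by rewrite sc1 sc1' mulr1.
have H1 u : `|H u| <= 1.
  by apply: (norm1 _ (c u * c' u - s u * s' u)); rewrite -(sccs u) /H; ring.
have G1 u : `|G u| <= 1.
  by apply: (norm1 _ (F u)); rewrite -(sccs u) /F /G; ring.
have dd_neq0 u : d u + d' u != 0.
  by rewrite gt_eqF // addr_gt0 //; [case: (dE u) | case: (dE' u)].
(* Substituting d - d' = beta^2 F H / (d + d') into F' = (d - d') G yields this factor. It is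
   bounded by beta^2, since |H| and |G| are at most 1 and d + d' >= 2. *)
pose m u := beta ^+ 2 * (H u * G u) / (d u + d' u).
have F0 : forall u, F u = 0.
  apply: (@gronwall_eq0 _ F m (beta ^+ 2)).
  - move=> u; rewrite (_ : m u * F u = (d u - d' u) * G u); first exact: DF.
    rewrite /m; apply: (mulIf (dd_neq0 u)).
    rewrite [RHS]mulrAC dd; field; exact: dd_neq0.
  - move=> u; rewrite /m normrM normfV ler_pdivrMr ?normr_gt0 //.
    rewrite normrM ger0_norm ?sqr_ge0 // ler_wpM2l ?sqr_ge0 // normrM.
    apply: (@le_trans _ _ (1 * 1)); first exact: ler_pM.
    by apply: le_trans (ler_norm _); have := d1 u; have := d1' u; lra.
  - by rewrite /F s0 s0'; ring.
(* With [F] zero, [G] has zero derivative and keeps its initial value; the addition formulas for x =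
   (x - x') + x' then give the equalities. *)
have GE u : G u = 1.
  transitivity (G 0); last by rewrite /G s0 s0' c0 c0'; ring.
  apply: is_derive_0_is_cst => x.
  by apply: (is_derive_eq (DG x)); rewrite F0 mulr0.
move=> u; split.
- transitivity (c' u * F u + s' u * G u); last by rewrite F0 GE; ring.
  by rewrite -[LHS]mulr1 -(sc1' u) /F /G; ring.
- transitivity (c' u * G u - s' u * F u); last by rewrite F0 GE; ring.
  by rewrite -[LHS]mulr1 -(sc1' u) /F /G; ring.
- apply/eqP; rewrite -subr_eq0; apply/eqP/(mulIf (dd_neq0 u)).
  by rewrite dd F0; ring.
Qed.

(** The profile [phi] is the Jacobi amplitude, whose sine, cosine and derivative are sn, cn and
    dn. *)
Lemma jacobi_triple_helicoid (R : realType) (beta : R) (phi : R -> R) :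
  helicoid_profile beta phi ->
  jacobi_triple beta (sin \o phi) (cos \o phi) (derive1 phi).
Proof.
move=> [dphi eqphi _ phi0 phi_gt0].
have D (u : R) : is_derive u 1 phi (derive1 phi u).
  by rewrite derive1E; apply: derivableP; case: (dphi u).
split=> [u|u|u|u|] /=.
- exact: is_derive1_comp.
- by apply: is_derive_eq; rewrite mulNr.
- by [].
- by rewrite addrC cos2Dsin2.
- by rewrite phi0 sin0 cos0.
Qed.

(** The bounds 0 < psi < pi make the third function positive; with the absolute values, the
    condition cos psi(0) > 0 selects the initial value 1, not - 1, for the second. *)
Lemma jacobi_triple_unduloid (R : realType) (alpha beta : R) (psi : R -> R) :
  beta != 0 -> alpha ^+ 2 = 1 + beta ^+ 2 -> unduloid_profile alpha psi ->
  jacobi_triple beta (fun u => derive1 psi u / `|beta|)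
    (fun u => `|alpha| * cos (psi u) / `|beta|)
    (fun u => `|alpha| * sin (psi u)).
Proof.
move=> beta_neq0 alpha_beta [dpsi eqpsi ddpsi dpsi0 [psi_pi cos0_gt0]].
have [B0 EB] : 0 < `|beta| /\ `|beta| ^+ 2 = beta ^+ 2.
  by rewrite normr_gt0 real_normK ?num_real.
have [A0 EA] : 0 < `|alpha| /\ `|alpha| ^+ 2 = 1 + beta ^+ 2.
  rewrite real_normK ?num_real // alpha_beta normr_gt0; split=> //.
  apply: contra_eq_neq alpha_beta => ->.
  by rewrite expr0n lt_eqF // ltr_wpDr ?sqr_ge0.
rewrite -EB in EA *; rewrite alpha_beta -EB -EA in eqpsi ddpsi.
set A := `|alpha| in A0 EA eqpsi ddpsi *; set B := `|beta| in B0 EB EA *.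
have B_neq0 : B != 0 by rewrite gt_eqF.
have D1 (u : R) : is_derive u 1 psi (derive1 psi u).
  by rewrite derive1E; apply: derivableP; case: (dpsi u).
have D2 (u : R) : is_derive u 1 (derive1 psi) (A ^+ 2 * sin (psi u) * cos (psi u)).
  by rewrite -ddpsi derive1E; apply: derivableP; case: (dpsi u).
have sq u : derive1 psi u ^+ 2 = A ^+ 2 * sin (psi u) ^+ 2 - 1.
  by rewrite -eqpsi addrC addKr.
split=> [u|u|u|u|].
- apply: (is_derive_eq (is_deriveM (D2 u) (is_derive_cst B^-1 u 1))).
  by rewrite /GRing.scale /=; field.
- have Dcos : is_derive u 1 (cos \o psi) (- sin (psi u) * derive1 psi u).
    exact: is_derive1_comp.
  apply: (is_derive_eq (is_deriveM (is_deriveZ A Dcos) (is_derive_cst B^-1 u 1))).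
  by rewrite /GRing.scale /=; field.
- rewrite mulr_gt0 ?sin_gt0_pi //; split=> //.
  by rewrite expr_div_n sq -EB; field.
- by rewrite !expr_div_n sq exprMn cos2sin2 EA; field.
- split; first by rewrite dpsi0 mul0r.
  (* At 0 the profile equation reads A^2 sin^2 psi = 1, so A^2 cos^2 psi = A^2 - 1 = B^2. *)
  have H : (A * cos (psi 0)) ^+ 2 = B ^+ 2.
    have := sq 0; rewrite dpsi0 expr0n exprMn cos2sin2 EA /=; lra.
  have -> : A * cos (psi 0) = B.
    by apply/eqP; rewrite -(@eqrXn2 _ 2) ?H // ltW // mulr_gt0.
  exact: divff.
Qed.

(** * Conjugation of the unduloid into the helicoid *)

Lemma du_J (R : realType) : du R *m J R = dv R.
Proof. by rewrite /du -rowE rowK. Qed.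

Lemma dv_J (R : realType) : dv R *m J R = - du R.
Proof. by rewrite /dv -rowE rowK. Qed.

Theorem proposition4p13 (R : realType) (alpha beta : R) (psi phi : R -> R)
    (alpha_gt1 : 1 < `|alpha|) (beta_neq0 : beta != 0)
    (alpha_beta : alpha ^+ 2 = 1 + beta ^+ 2)
    (same_sign : Num.sg beta = Num.sg alpha)
    (psi_profile : unduloid_profile alpha psi)
    (phi_profile : helicoid_profile beta phi) :
  conjugate_surface (unduloid_immersion alpha psi) (helicoid beta phi).
Proof.
have xE : unduloid_immersion alpha psi = screw_immersion alpha 1 0 psi.
  apply/funext => p; rewrite /unduloid_immersion /screw_immersion.
  by congr vec4; ring.
have yE : helicoid_immersion beta phi = screw_immersion beta 0 1 phi.
  apply/funext => p; rewrite /helicoid_immersion /screw_immersion.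
  by congr vec4; ring.
have x_prof : screw_profile alpha 1 0 psi.
  case: psi_profile => dpsi eqpsi ddpsi _ _; split=> //; try by ring.
  by move=> u; have := eqpsi u; lra.
have y_prof : screw_profile beta 0 1 phi.
  case: phi_profile => dphi eqphi ddphi _ _; split=> //; try by ring.
  by move=> u; have := eqphi u; lra.
have B_neq0 : `|beta| != 0 by rewrite normr_eq0.
have jacobi u : [/\ `|beta| * sin (phi u) = derive1 psi u,
    `|beta| * cos (phi u) = `|alpha| * cos (psi u) &
    derive1 phi u = `|alpha| * sin (psi u)].
  have [/= -> -> ->] := jacobi_triple_unique (jacobi_triple_helicoid phi_profile)
    (jacobi_triple_unduloid beta_neq0 alpha_beta psi_profile) u.
  by split=> //; field.
(* The common sign of [alpha] and [beta] turns the identities in absolute values into signed ones: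
   this one for the shape operators, the next for the angle functions. *)
have cosE u : beta * cos (phi u) = alpha * cos (psi u).
  have [_ E _] := jacobi u.
  by rewrite (numEsg beta) (numEsg alpha) same_sign -!mulrA E.
have sinE u : derive1 phi u * (beta * sin (phi u))
    = derive1 psi u * (alpha * sin (psi u)).
  have [E _ ->] := jacobi u.
  by rewrite -E {1}(numEsg beta) {2}(numEsg alpha) same_sign; ring.
have factorE u : screw_factor 0 phi u = screw_factor 1 psi u.
  have [_ _ E] := jacobi u; case: x_prof => _ /(_ u) eqpsi _ _ _.
  rewrite /screw_factor eqpsi E exprMn real_normK ?num_real //.
exists (helicoid_immersion beta phi); last first.
  exists 1%:M, 0; rewrite trmx1 !mulmx1 det1; split=> //.
  rewrite /helicoid (_ : (fun w => _) = id) ?image_id //.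
  by apply/funext => w; rewrite mulmx1 scale0r addr0.
rewrite xE yE; split; [exact: conformal_minimal_screw | exact: conformal_minimal_screw |].
exists (induced_metric (screw_immersion alpha 1 0 psi)), (screw_shape alpha 1 0 psi),
  (screw_vertical 1 0 psi), (angle_function (screw_normal alpha 1 0 psi)).
split; first exact: has_data_screw.
have [N [unitN _ SE TE nuE]] := has_data_screw y_prof.
exists N; split=> [|p X Y|||p].
- exact: unitN.
- by rewrite !induced_metric_screw // factorE.
(* The scalar factors agree by [cosE] and [factorE]; the rows - du, dv of the unduloid become - dv,
   - du under [J], which is the pattern of the helicoid. *)
- rewrite (_ : (fun p => _) = screw_shape beta 0 1 phi); first exact: SE.
  apply/funext => p; rewrite /screw_shape cosE factorE -scalemxAl; congr (_ *: _).
  apply/row_matrixP => -[[|[|//]]] lti; rewrite row_mul !rowK /=.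
    by rewrite mulmxBl -!scalemxAl du_J dv_J !(oppr0, scale0r, subr0, scaleNr) sub0r.
  by rewrite mulmxDl -!scalemxAl du_J dv_J
    !(oppr0, scale0r, scalerN, scaleNr, add0r, addr0).
- rewrite (_ : (fun p => _) = screw_vertical 0 1 phi); first exact: TE.
  apply/funext => p; rewrite /screw_vertical factorE -scalemxAl; congr (_ *: _).
  by rewrite mulmxDl -!scalemxAl du_J dv_J !scale0r scale1r addr0 add0r.
- by rewrite -nuE !angle_function_screw sinE factorE.
Qed.
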